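(* Define integer sequences by the power series expansions $$\frac{(q^4,q^{10};q^{14})_\infty}{(q^{3},q^{11};q^{14})_\infty}=\sum_{n\ge0}\alpha_nq^n,\qquad \frac{(q^2,q^{12};q^{14})_\infty}{(q^{5},q^{9};q^{14})_\infty}=\sum_{n\ge0}\beta_nq^n,\qquad \frac{(q^6,q^{8};q^{14})_\infty}{(q,q^{13};q^{14})_\infty}=\sum_{n\ge0}\gamma_nq^n,$$ $$\frac{(q,q^{27};q^{28})_\infty}{(q^{13},q^{15};q^{28})_\infty}=\sum_{n\ge0}\alpha'_nq^n,\qquad \frac{(q^3,q^{25};q^{28})_\infty}{(q^{11},q^{17};q^{28})_\infty}=\sum_{n\ge0}\beta'_nq^n,\qquad \frac{(q^5,q^{23};q^{28})_\infty}{(q^{9},q^{19};q^{28})_\infty}=\sum_{n\ge0}\gamma'_nq^n.$$ Then for all integers $n\ge0$: (i) $\alpha_{7n+1}=0$; (ii) $\beta_{7n+6}=0$; (iii) $\gamma_{7n+6}=0$; (iv) $\alpha'_{14n+7}=0$; (v) $\beta'_{14n+4}=0$; (vi) $\gamma'_{14n+11}=0$.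
   Context: $(\lambda;q)_\infty=\prod_{t\ge0}(1-\lambda q^t)$ and $(a,b;q)_\infty=(a;q)_\infty(b;q)_\infty$, viewed as formal power series in $q$. *)

(* Defs.v *)
From mathcomp Require Import all_boot all_order all_algebra.

Set Implicit Arguments.
Unset Strict Implicit.
Unset Printing Implicit Defensive.

Import GRing.Theory.
Local Open Scope ring_scope.

(* Z[[q]], a series being identified with its coefficient sequence. *)
Definition fps := nat -> int.

Definition fps_mul (f g : fps) : fps :=
  fun n => \sum_(i < n.+1) f i * g (n - i)%N.

(* Long division: s holds the coefficients of f / g below size s. *)
Definition fps_div_step (f g : fps) (s : seq int) : seq int :=
  rcons s ((f (size s) - \sum_(i < size s) s`_i * g (size s - i)%N) / g 0%N).

Definition fps_div_seq (f g : fps) (n : nat) : seq int :=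
  iter n (fps_div_step f g) [::].

(* Meaningful when g 0 is a unit of int; see fps_divK and fps_div_unique. *)
Definition fps_div (f g : fps) : fps := fun n => (fps_div_seq f g n.+1)`_n.

(* (a; b)_oo = prod_(t >= 0) (1 - a b^t) as a series in q = 'X, where b has zero
   constant term: the factors with t > n do not affect the coefficient of q^n
   (see qpoch_stable), so n.+1 factors determine it. *)
Definition qpoch (a b : {poly int}) : fps :=
  fun n => (\prod_(t < n.+1) (1 - a * b ^+ t))`_n.

Definition qpoch2 (a1 a2 b : {poly int}) : fps :=
  fps_mul (qpoch a1 b) (qpoch a2 b).

Lemma coef_expr_small (b : {poly int}) (t k : nat) :
  b`_0 = 0 -> (k < t)%N -> (b ^+ t)`_k = 0.
Proof.
move=> b0; elim: t k => [//|t IH] k lt_kt.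
rewrite exprS coefM big1 // => -[[|i] /= lti] _; first by rewrite b0 mul0r.
rewrite IH ?mulr0 //; case: k lt_kt lti => [|k] //= lt_kt lti.
by rewrite subSS (leq_ltn_trans (leq_subr _ _)).
Qed.

Lemma qpoch_stable (a b : {poly int}) (n N : nat) :
  b`_0 = 0 -> (n < N)%N ->
  (\prod_(t < N) (1 - a * b ^+ t))`_n = qpoch a b n.
Proof.
move=> b0; elim: N => [//|N IH]; rewrite ltnS leq_eqVlt => /orP[/eqP-> //|ltnN].
rewrite big_ord_recr /= mulrBr mulr1 coefB IH // mulrA [X in _ - X]coefM.
rewrite big1 ?subr0 // => i _.
by rewrite (coef_expr_small b0) ?mulr0 // (leq_ltn_trans (leq_subr _ _)).
Qed.

Lemma size_fps_div_seq (f g : fps) (n : nat) : size (fps_div_seq f g n) = n.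
Proof. by elim: n => //= n IH; rewrite /fps_div_step size_rcons IH. Qed.

Lemma nth_fps_div_seq (f g : fps) (n i : nat) :
  (i < n)%N -> (fps_div_seq f g n)`_i = fps_div f g i.
Proof.
elim: n => [//|n IH]; rewrite ltnS leq_eqVlt => /orP[/eqP-> //|ltin].
by rewrite /= /fps_div_step nth_rcons size_fps_div_seq ltin IH.
Qed.

Lemma fps_divE (f g : fps) (n : nat) :
  fps_div f g n
  = (f n - \sum_(i < n) fps_div f g i * g (n - i)%N) / g 0%N.
Proof.
rewrite {1}/fps_div /= -/(fps_div_seq f g n) /fps_div_step nth_rcons.
rewrite size_fps_div_seq ltnn eqxx.
congr ((_ - _) / _); apply: eq_bigr => i _.
by rewrite nth_fps_div_seq ?ltn_ord.
Qed.

Lemma fps_divK (f g : fps) :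
  g 0%N \is a GRing.unit -> fps_mul (fps_div f g) g =1 f.
Proof.
move=> g0 n; rewrite /fps_mul big_ord_recr /= subnn [fps_div f g n]fps_divE.
by rewrite divrK // addrC subrK.
Qed.

Lemma fps_div_unique (f g h : fps) :
  g 0%N \is a GRing.unit -> fps_mul h g =1 f -> h =1 fps_div f g.
Proof.
move=> g0 hg n; elim/ltn_ind: n => n IH; rewrite fps_divE -hg.
rewrite /fps_mul big_ord_recr /= subnn.
rewrite [X in _ - X](eq_bigr (fun i : 'I_n => h i * g (n - i)%N)).
  by rewrite [X in X - _]addrC addrK mulrK.
by move=> i _; rewrite IH.
Qed.

Lemma qpoch2_0 (a1 a2 b : {poly int}) :
  a1`_0 = 0 -> a2`_0 = 0 -> qpoch2 a1 a2 b 0%N = 1.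
Proof.
move=> a10 a20; rewrite /qpoch2 /fps_mul /qpoch big_ord1 !big_ord1.
by rewrite !expr0 !mulr1 !coefB !coef1 a10 a20 !subr0.
Qed.

(* Main.v *)
(* Put [p = r + s], [a = q^r] and [Theta(z) = (z, q^(2p)/z; q^(2p))_oo].  All six series
   have the form [Theta(a) / Theta(a q^p)] with [s] odd and coprime to [r].  By the
   Jacobi triple product the quotient is that of two theta series, and comparing
   coefficients of [a^N] shows that it equals [L / K], where
     [L = sum_(j in Z) a^j q^(-p j) / (1 - q^(p (1 - 2 j)))]
   and [K] is a series in [q^p] with constant term [1] (this is a case of Ramanujan's
   1psi1 summation).  Hence a residue class modulo [p] is free of exponents of the
   quotient as soon as it is free of exponents of [L].  In the class of
   [r (s + 1) / 2] the surviving [j] are [(s + 1) / 2 + p i], and expanding the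
   denominators gives a double sum over [i], [k] on which exchanging [i] and [k] acts by
   [-1], so it vanishes. *)
Require Import Defs.
From mathcomp Require Import all_boot all_order all_algebra.
From mathcomp Require Import zify ring.
From mathcomp Require Import boolp classical_sets fsbigop.

Set Implicit Arguments.
Unset Strict Implicit.
Unset Printing Implicit Defensive.

Import Order.TTheory GRing.Theory Num.Theory.
Local Open Scope ring_scope.

(** * Ring laws for formal power series *)

(** Truncation lets series inherit the ring laws of [{poly int}]. *)
Lemma fps_mul_poly (f g : fps) (M n : nat) : (n < M)%N ->
  fps_mul f g n = ((\poly_(i < M) f i) * (\poly_(i < M) g i))`_n.
Proof.
move=> ltnM; rewrite coefM; apply: eq_bigr => i _.
rewrite !coef_poly (leq_ltn_trans (leq_subr _ _) ltnM).
by rewrite (leq_ltn_trans _ ltnM) // -ltnS.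
Qed.

Lemma fps_mulC (f g : fps) : fps_mul f g = fps_mul g f.
Proof.
apply: funext => n.
by rewrite !(fps_mul_poly _ _ (ltnSn n)) mulrC.
Qed.

Lemma fps_mulA (f g h : fps) : fps_mul f (fps_mul g h) = fps_mul (fps_mul f g) h.
Proof.
have coef_eq (u v w : {poly int}) n :
    (forall i, (i <= n)%N -> u`_i = v`_i) -> (w * u)`_n = (w * v)`_n.
  by move=> uv; rewrite !coefM; apply: eq_bigr => i _; rewrite uv ?leq_subr.
have mulE n (u v : fps) i : (i <= n)%N -> (\poly_(j < n.+1) fps_mul u v j)`_i =
    ((\poly_(j < n.+1) u j) * (\poly_(j < n.+1) v j))`_i.
  by move=> lein; rewrite coef_poly ltnS lein (@fps_mul_poly u v n.+1).
apply: funext => n; rewrite !(fps_mul_poly _ _ (ltnSn n)).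
rewrite (coef_eq _ _ _ _ (mulE n g h)) [X in _ = (polyseq X)`_n]mulrC.
rewrite (coef_eq _ _ _ _ (mulE n f g)).
by rewrite mulrA [in RHS]mulrC.
Qed.

Lemma fps_mulI (f g h : fps) :
  h 0%N \is a GRing.unit -> fps_mul f h = fps_mul g h -> f = g.
Proof.
move=> h0 fg; apply: funext => n.
rewrite (@fps_div_unique (fps_mul g h) h f h0) ?fg //.
by rewrite (@fps_div_unique (fps_mul g h) h g h0).
Qed.

(** * Series indexed by a countable family of monomials *)

(** A sum over [[set: I]] with infinitely many nonzero terms is 0 by convention, hence the recurring
    hypothesis [locally_finite]. *)
Definition zser (I : choiceType) (w e : I -> int) : fps :=
  fun n => \sum_(x \in [set: I]) w x *+ (e x == n%:Z).

(** With the bound [e x <= n] instead of equality, one list serves every splitting of [n] in a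
    product of two series. *)
Definition locally_finite (I : choiceType) (w e : I -> int) : Prop :=
  forall n : nat, exists2 s : seq I,
    uniq s & forall x, w x != 0 -> e x <= n%:Z -> x \in s.

Section ZSer.
Variable I : choiceType.
Implicit Types (w e : I -> int).

Lemma zserE w e (s : seq I) n :
  uniq s -> (forall x, w x != 0 -> e x = n%:Z -> x \in s) ->
  zser w e n = \sum_(x <- s) w x *+ (e x == n%:Z).
Proof.
move=> us sP; rewrite (@bigfs _ _ _ _ s predT) // => [|x _ xs].
  by apply: eq_fsbigl; apply/seteqP; split.
have [ex|//] := eqVneq (e x) n%:Z; apply/eqP/negPn.
by apply: contra xs => /sP; apply.
Qed.

Lemma eq_zser w e w' e' : w =1 w' -> (forall x, w x != 0 -> e x = e' x) ->
  zser w e = zser w' e'.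
Proof.
move=> ww' ee'; apply: funext => n; apply: eq_fsbigr => x _.
rewrite -ww'; have [->|/ee' -> //] := eqVneq (w x) 0; by rewrite !mul0rn.
Qed.

Lemma zser_eq0 w e n : (forall x, w x != 0 -> e x != n%:Z) -> zser w e n = 0.
Proof.
move=> H; rewrite (@zserE w e [::]) ?big_nil // => x /H /eqP; by [].
Qed.

Lemma zser_reindex (J : choiceType) (h : J -> I) w e : bijective h ->
  zser w e = zser (w \o h) (e \o h).
Proof. by move=> hb; apply: funext => n; rewrite /zser (reindex_fsbigT h). Qed.

Lemma zserB w w' e : locally_finite w e -> locally_finite w' e ->
  zser (fun x => w x - w' x) e = fun n => zser w e n - zser w' e n.
Proof.
move=> lw lw'; apply: funext => n; have [s us sP] := lw n; have [s' us' s'P] := lw' n.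
have ut : uniq (undup (s ++ s')) by rewrite undup_uniq.
rewrite !(@zserE _ e (undup (s ++ s')) n ut).
- by rewrite -sumrB; apply: eq_bigr => x _; rewrite mulrnBl.
- by move=> x wx ex; rewrite mem_undup mem_cat s'P ?orbT ?ex.
- by move=> x wx ex; rewrite mem_undup mem_cat sP ?ex.
move=> x; rewrite mem_undup mem_cat => wx ex; apply/orP.
have [w0|w0] := eqVneq (w x) 0; last by left; rewrite sP ?ex.
by right; rewrite s'P ?ex //; apply: contra wx => /eqP->; rewrite w0 subrr.
Qed.

(** Reindexing along [h] shows that each coefficient equals its opposite. *)
Lemma zser_anti (h : I -> I) w e : involutive h ->
  (forall x, w (h x) = - w x) -> (forall x, w x != 0 -> e (h x) = e x) ->
  forall n, zser w e n = 0.
Proof.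
move=> hK wh eh n.
suff: zser w e n = - zser w e n by lia.
have bh : bijective h by exists h.
rewrite {1}(zser_reindex w e bh).
rewrite (@eq_zser _ _ (fun x => -1 * w x) e) => [|x|x]; first last.
- by rewrite /= wh oppr_eq0 => /eh.
- by rewrite /= wh mulN1r.
rewrite /zser -[RHS]mulN1r mulr_fsumr; apply: eq_fsbigr => x _.
by rewrite mulrnAr.
Qed.

End ZSer.

(** As exponents are nonnegative, a pair of total exponent [n] has both exponents at most [n], and
    it is counted once in the Cauchy product, at [i = e x]. *)
Lemma zser_mul (I J : choiceType) (w e : I -> int) (w' e' : J -> int) :
  (forall x, w x != 0 -> 0 <= e x) -> locally_finite w e ->
  (forall x, w' x != 0 -> 0 <= e' x) -> locally_finite w' e' ->
  fps_mul (zser w e) (zser w' e') =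
  zser (fun x : I * J => w x.1 * w' x.2) (fun x => e x.1 + e' x.2).
Proof.
move=> e0 lw e'0 lw'; apply: funext => n.
have [s us sP] := lw n; have [s' us' s'P] := lw' n.
rewrite (@zserE _ _ _ [seq (x, y) | x <- s, y <- s']); first last.
- move=> [x y] /=; rewrite mulf_eq0 negb_or => /andP[wx wy] exy.
  have := e0 x wx; have := e'0 y wy => ey ex.
  by apply/allpairsP; exists (x, y); split=> //=; [apply: sP|apply: s'P] => //; lia.
- by rewrite allpairs_uniq // => -[? ?] [? ?].
rewrite big_allpairs /= /fps_mul.
transitivity (\sum_(i < n.+1) \sum_(x <- s) \sum_(y <- s')
   (w x *+ (e x == i%:Z)) * (w' y *+ (e' y == (n - i)%N%:Z))).
  apply: eq_bigr => i _; have := ltn_ord i => lti.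
  rewrite (@zserE _ _ _ s) // => [|x wx ex]; last by apply: sP; lia.
  rewrite (@zserE _ _ _ s') // => [|x wx ex]; last by apply: s'P; lia.
  by rewrite big_distrl; apply: eq_bigr => x _; rewrite big_distrr.
rewrite exchange_big; apply: eq_bigr => x _; rewrite exchange_big.
apply: eq_bigr => y _.
have [wx|wx] := eqVneq (w x) 0.
  by rewrite wx mul0r mul0rn big1 // => i _; rewrite mul0rn mul0r.
have [wy|wy] := eqVneq (w' y) 0.
  by rewrite wy mulr0 mul0rn big1 // => i _; rewrite mul0rn mulr0.
have := e0 x wx; have := e'0 y wy => ey ex.
have [exy|exy] := eqVneq (e x + e' y) n%:Z; last first.
  rewrite big1 // => i _; have := ltn_ord i => lti.
  have [Ei|_] := eqVneq (e x) i%:Z; last by rewrite mulr0n mul0r.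
  have [Ej|_] := eqVneq (e' y) (n - i)%N%:Z; last by rewrite mulr0n mulr0.
  by move: exy; lia.
have lx : (`|e x| < n.+1)%N by lia.
rewrite (bigD1 (Ordinal lx)) //= big1 ?addr0 => [|i /eqP ne].
  have -> : e x == `|e x|%N%:Z by lia.
  have -> : e' y == (n - `|e x|)%N%:Z by lia.
  by rewrite !mulr1n.
have [Ei|_] := eqVneq (e x) i%:Z; last by rewrite mulr0n mul0r.
by case: ne; apply: val_inj => /=; rewrite Ei.
Qed.

Definition int_box (L : nat) : seq int := [seq i%:Z - L%:Z | i <- iota 0 L.*2.+1].

Lemma int_box_uniq L : uniq (int_box L).
Proof. by rewrite map_inj_uniq ?iota_uniq // => i j; lia. Qed.

Lemma mem_int_box (L : nat) (z : int) : (`|z| <= L)%N -> z \in int_box L.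
Proof.
move=> zL; apply/mapP; exists (absz (z + L%:Z)); last by lia.
by rewrite mem_iota; lia.
Qed.

Lemma locally_finite_int (w e : int -> int) (c : nat) :
  (forall x, w x != 0 -> `|x|%N%:Z <= e x + c%:Z) -> locally_finite w e.
Proof.
move=> H n; exists (int_box (n + c)); first exact: int_box_uniq.
by move=> x /H lx le; apply: mem_int_box; lia.
Qed.

Lemma locally_finite_int2 (w e : int * int -> int) (c : nat) :
  (forall i j, w (i, j) != 0 -> (`|i| + `|j|)%N%:Z <= e (i, j) + c%:Z) ->
  locally_finite w e.
Proof.
move=> H n; exists [seq (i, j) | i <- int_box (n + c), j <- int_box (n + c)].
  by rewrite allpairs_uniq ?int_box_uniq // => -[? ?] [? ?].
have ijP (i j : int) : w (i, j) != 0 -> e (i, j) <= n%:Z ->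
    (`|i| <= n + c)%N /\ (`|j| <= n + c)%N by move=> /H; lia.
move=> [i j] wij eij; have [li lj] := ijP i j wij eij.
by apply/allpairsP; exists (i, j); split=> //; apply: mem_int_box.
Qed.

Lemma locally_finite_mul (I J : choiceType) (w e : I -> int) (w' e' : J -> int) :
  (forall x, w x != 0 -> 0 <= e x) -> locally_finite w e ->
  (forall x, w' x != 0 -> 0 <= e' x) -> locally_finite w' e' ->
  locally_finite (fun x : I * J => w x.1 * w' x.2) (fun x => e x.1 + e' x.2).
Proof.
move=> e0 lw e'0 lw' n; have [s us sP] := lw n; have [s' us' s'P] := lw' n.
exists [seq (x, y) | x <- s, y <- s'].
  by rewrite allpairs_uniq // => -[? ?] [? ?].
move=> [x y] /=; rewrite mulf_eq0 negb_or => /andP[wx wy] exy.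
have := e0 x wx; have := e'0 y wy => ey ex.
by apply/allpairsP; exists (x, y); split=> //=; [apply: sP|apply: s'P] => //; lia.
Qed.

Lemma locally_finite_reindex (I J : choiceType) (h : J -> I) (w e : I -> int) :
  bijective h -> locally_finite w e -> locally_finite (w \o h) (e \o h).
Proof.
move=> [g hK gK] lw n; have [s us sP] := lw n; exists (map g s).
  by rewrite map_inj_uniq //; apply: can_inj gK.
by move=> y /= wy ey; rewrite -[y]hK map_f // sP.
Qed.

(** * The theta series and the Lambert series *)

Definition theta_wt (n : int) : int := (-1) ^+ `|n|%N.
Definition theta_exp (p r : nat) (n : int) : int :=
  p%:Z * (n * n - n) + r%:Z * n.
(** By the Jacobi triple product this is (q^r, q^(2p-r), q^(2p); q^(2p))_oo. *)
Definition theta (p r : nat) : fps := zser theta_wt (theta_exp p r).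

(* The coefficient of [x^(k (1 - 2 j))] in [1 / (1 - x^(1 - 2 j))], expanded
   at [x = 0] whatever the sign of [1 - 2 j]. *)
Definition cone (j k : int) : int :=
  (if 0 <= k then 1 else 0) - (if 0 < j then 1 else 0).

(** With a = q^r and p = r + s, the numerator a^j q^(-p j) of L has exponent (r - p) j = - s j. *)
Definition lambert_exp (r s : nat) (x : int * int) : int :=
  (r + s)%N%:Z * (x.2 * (1 - 2 * x.1)) - s%:Z * x.1.
Definition lambert (r s : nat) : fps :=
  zser (fun x => cone x.1 x.2) (lambert_exp r s).

(** K is the sum over j of (-1)^j q^(p (j^2 - j)) / (1 - q^(p (1 - 2 j))), expanded by [cone]. *)
Definition kfactor_exp (p : nat) (x : int * int) : int :=
  p%:Z * (x.1 * x.1 - x.1 + x.2 * (1 - 2 * x.1)).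
Definition kfactor_wt (x : int * int) : int := theta_wt x.1 * cone x.1 x.2.
Definition kfactor (p : nat) : fps := zser kfactor_wt (kfactor_exp p).

Lemma theta_wtD m n : theta_wt (m + n) = theta_wt m * theta_wt n.
Proof.
rewrite /theta_wt -[LHS]signr_odd -[X in X * _]signr_odd -[X in _ * X]signr_odd.
by rewrite -signr_addb; congr (_ ^+ nat_of_bool _); lia.
Qed.

Lemma theta_wtN n : theta_wt (- n) = theta_wt n.
Proof. by rewrite /theta_wt abszN. Qed.

Lemma cone_neq0 j k : cone j k != 0 -> (j <= 0 /\ 0 <= k) \/ (1 <= j /\ k < 0).
Proof. by rewrite /cone; case: ifP; case: ifP; lia. Qed.

(** The exponent is p (n^2 - |n|) plus r |n| for n >= 0, or plus (2p - r) |n| for n <= 0. *)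
Lemma theta_exp_ge (p r : nat) n : (0 < r < p.*2)%N ->
  `|n|%N%:Z <= theta_exp p r n.
Proof.
move=> rp; rewrite /theta_exp.
have p0 : 0 <= p%:Z * (n * n - `|n|%N%:Z).
  by apply: mulr_ge0 => //; case: n => n; nia.
case: (lerP n 0) => n0.
  have : 0 <= (p.*2 - r - 1)%N%:Z * (- n) by apply: mulr_ge0 => //; lia.
  by have -> : (p.*2 - r - 1)%N%:Z = 2 * p%:Z - r%:Z - 1; lia.
have : 0 <= (r - 1)%N%:Z * n by apply: mulr_ge0 => //; lia.
by have -> : (r - 1)%N%:Z = r%:Z - 1; lia.
Qed.

(** For j <= 0 <= k the exponent is 2p k (-j) + p k + s (-j). On the other branch, with j' = j - 1
    and k' = -k - 1, it is 2p j' k' + p (j' + k') + r j; the slack 1 comes from |k| = k' + 1. *)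
Lemma lambert_exp_ge (r s : nat) j k : (0 < r)%N -> (0 < s)%N ->
  cone j k != 0 -> 0 <= lambert_exp r s (j, k) /\
  (`|j| + `|k|)%N%:Z <= lambert_exp r s (j, k) + 1.
Proof.
move=> r0 s0 /cone_neq0 [[j0 k0]|[j0 k0]]; rewrite /lambert_exp /=.
  have : 0 <= (r + s)%N%:Z * (k * (- j)) by rewrite !mulr_ge0 //; lia.
  have : 0 <= (r + s - 1)%N%:Z * k by rewrite mulr_ge0.
  have : 0 <= (s - 1)%N%:Z * (- j) by rewrite mulr_ge0 //; lia.
  have -> : (r + s - 1)%N%:Z = r%:Z + s%:Z - 1 by lia.
  by have -> : (s - 1)%N%:Z = s%:Z - 1; lia.
have : 0 <= (r + s)%N%:Z * ((- k - 1) * (j - 1)) by rewrite !mulr_ge0 //; lia.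
have : 0 <= (r + s - 1)%N%:Z * (- k - 1) by rewrite mulr_ge0 //; lia.
have : 0 <= (r - 1)%N%:Z * j by rewrite mulr_ge0 //; lia.
have : 0 <= (r + s)%N%:Z * (j - 1) by rewrite mulr_ge0 //; lia.
have -> : (r + s - 1)%N%:Z = r%:Z + s%:Z - 1 by lia.
by have -> : (r - 1)%N%:Z = r%:Z - 1; lia.
Qed.

Lemma kfactor_exp_ge (p : nat) j k : (0 < p)%N -> cone j k != 0 ->
  0 <= kfactor_exp p (j, k) /\ (`|j| + `|k|)%N%:Z <= kfactor_exp p (j, k) + 1.
Proof.
move=> p0 /cone_neq0 H; rewrite /kfactor_exp /=.
set E := _ + _ * (1 - _).
have E0 : (`|j| + `|k|)%N%:Z <= E + 1 /\ 0 <= E.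
  case: H => -[j0 k0].
    have : 0 <= k * (- j) by rewrite mulr_ge0 //; lia.
    have : 0 <= j * j by rewrite -expr2 sqr_ge0.
    by rewrite /E; lia.
  have : 0 <= (- k - 1) * (j - 1) by rewrite mulr_ge0 //; lia.
  have : 0 <= (j - 1) * (j - 1) by rewrite -expr2 sqr_ge0.
  by rewrite /E; lia.
have : 0 <= (p - 1)%N%:Z * E by rewrite mulr_ge0 //; lia.
by have -> : (p - 1)%N%:Z = p%:Z - 1; lia.
Qed.

Section ThetaLambert.
Variables (r s : nat).
Hypotheses (r_gt0 : (0 < r)%N) (s_gt0 : (0 < s)%N).
Let p := (r + s)%N.

Let theta1_exp_ge n : `|n|%N%:Z <= theta_exp p r n.
Proof. by apply: theta_exp_ge; rewrite /p; lia. Qed.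

Let theta2_exp_ge n : `|n|%N%:Z <= theta_exp p (r + p) n.
Proof. by apply: theta_exp_ge; rewrite /p; lia. Qed.

Let theta1_fin : locally_finite theta_wt (theta_exp p r).
Proof. by apply: (@locally_finite_int _ _ 0) => n _; rewrite addr0. Qed.

Let theta2_fin : locally_finite theta_wt (theta_exp p (r + p)).
Proof. by apply: (@locally_finite_int _ _ 0) => n _; rewrite addr0. Qed.

Let lambert_fin : locally_finite (fun x => cone x.1 x.2) (lambert_exp r s).
Proof.
by apply: (@locally_finite_int2 _ _ 1) => j k /(lambert_exp_ge r_gt0 s_gt0)[].
Qed.

Let lambert_ge0 x : cone x.1 x.2 != 0 -> 0 <= lambert_exp r s x.
Proof. by case: x => j k /(lambert_exp_ge r_gt0 s_gt0)[]. Qed.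

Let kfactor_neq0 x : kfactor_wt x != 0 -> cone x.1 x.2 != 0.
Proof. by apply: contra => /eqP; rewrite /kfactor_wt => ->; rewrite mulr0. Qed.

Let p_gt0 : (0 < p)%N. Proof. by rewrite /p; lia. Qed.

Let kfactor_fin : locally_finite kfactor_wt (kfactor_exp p).
Proof.
by apply: (@locally_finite_int2 _ _ 1) => j k /kfactor_neq0/(kfactor_exp_ge p_gt0)[].
Qed.

Let kfactor_ge0 x : kfactor_wt x != 0 -> 0 <= kfactor_exp p x.
Proof. by move=> /kfactor_neq0; case: x => j k /(kfactor_exp_ge p_gt0)[]. Qed.

(** On the branch j <= 0 <= k the exponent vanishes only at j = k = 0; on the branch j >= 1, k < 0
    it is at least p. *)
Lemma kfactor0 : kfactor p 0 = 1.
Proof.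
rewrite /kfactor (@zserE _ _ _ [:: (0, 0)]) //.
  by rewrite big_seq1 /kfactor_wt /kfactor_exp /cone /= mulr0 eqxx.
move=> [j k] /kfactor_neq0 /= cjk E.
have [_] := kfactor_exp_ge p_gt0 cjk; rewrite E.
have := cone_neq0 cjk => jk le; suff [-> ->] : j = 0 /\ k = 0 by rewrite inE.
move: E; rewrite /kfactor_exp /= => /eqP; rewrite mulf_eq0.
have /negPf-> /= : p%:Z != 0 by lia.
by case: jk => -[j0 k0] /eqP; nia.
Qed.

Lemma kfactor_supp n : ~~ (p %| n)%N -> kfactor p n = 0.
Proof.
move=> pn; apply: zser_eq0 => -[j k] _; apply: contra pn => /eqP.
by rewrite /kfactor_exp /= => E; have: (p%:Z %| n%:Z)%Z by rewrite -E dvdz_mulr.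
Qed.

(* With [N = n + j] and [k] shifted by [N], both products are sums over the same
   monomials, and the difference of the weights is [(-1)^(N + j)] times a factor
   free of [j]; the substitution [j -> 2 k + 1 - j] fixes the exponent and
   changes the sign. *)
Lemma theta_lambert :
  fps_mul (theta p (r + p)) (lambert r s) = fps_mul (theta p r) (kfactor p).
Proof.
have T1ge0 n : theta_wt n != 0 -> 0 <= theta_exp p r n.
  by move=> _; apply: le_trans (theta1_exp_ge n).
have T2ge0 n : theta_wt n != 0 -> 0 <= theta_exp p (r + p) n.
  by move=> _; apply: le_trans (theta2_exp_ge n).
have finL := locally_finite_mul T2ge0 theta2_fin lambert_ge0 lambert_fin.
have finR := locally_finite_mul T1ge0 theta1_fin kfactor_ge0 kfactor_fin.
pose X := (int * (int * int))%type.
pose h (x : X) : X := (x.1 - x.2.1, (x.2.1, x.2.2 - x.1)).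
have bh : bijective h.
  exists (fun x => (x.1 + x.2.1, (x.2.1, x.2.2 + (x.1 + x.2.1)))) => -[n [j k]];
    by rewrite /h /=; congr (_, (_, _)); ring.
pose wL (x : X) := theta_wt x.1 * cone x.2.1 x.2.2.
pose eL (x : X) := theta_exp p (r + p) x.1 + lambert_exp r s x.2.
pose wR (x : X) := theta_wt x.1 * kfactor_wt x.2.
pose eR (x : X) := theta_exp p r x.1 + kfactor_exp p x.2.
have eLR : eL \o h = eR.
  apply: funext => -[n [j k]].
  rewrite /eL /eR /theta_exp /lambert_exp /kfactor_exp /=.
  by rewrite /p !PoszD; ring.
have finLh : locally_finite (wL \o h) eR.
  by rewrite -eLR; apply: locally_finite_reindex.
have -> : fps_mul (theta p (r + p)) (lambert r s) = zser (wL \o h) eR.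
  by rewrite -eLR -zser_reindex //; apply: zser_mul.
have -> : fps_mul (theta p r) (kfactor p) = zser wR eR by apply: zser_mul.
apply: funext => n; apply/eqP; rewrite -subr_eq0; apply/eqP.
have /(congr1 (fun f : fps => f n)) <- := zserB finLh finR.
apply: (@zser_anti _ (fun x => (x.1, (2 * x.2.2 + 1 - x.2.1, x.2.2)))).
- by move=> [N [j k]] /=; congr (_, (_, _)); ring.
- move=> [N [j k]] /=; rewrite /wL /wR /kfactor_wt /cone /=.
  rewrite !(theta_wtD, theta_wtN).
  have -> : theta_wt (2 * k) = 1 by rewrite /theta_wt abszM exprM sqrrN !expr1n.
  have -> : theta_wt 1 = -1 by [].
  by ring.
move=> [N [j k]] _; rewrite /eR /kfactor_exp /=; ring.
Qed.

End ThetaLambert.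

(** * Vanishing along a residue class *)

(* Congruence forces [j = j0 + p i] with [2 j0 = s + 1]; in the coordinates [i], [k]
   the exponent is symmetric while the weight is [(0 <= k) - (0 <= i)]. *)
Lemma lambert_eq0 (r s n : nat) : (0 < r)%N -> odd s -> coprime r s ->
  n = r * s.+1./2 %[mod r + s] -> lambert r s n = 0.
Proof.
move=> r0 os crs nE; set j0 := s.+1./2%N in nE *; set p := (r + s)%N in nE *.
have sE : s%:Z = 2 * j0%:Z - 1 by rewrite /j0; lia.
have p0 : p%:Z != 0 by rewrite /p; lia.
pose dv (x : int * int) := (p%:Z %| x.1 - j0%:Z)%Z.
pose w x := if dv x then cone x.1 x.2 else 0.
transitivity (zser w (lambert_exp r s) n).
  apply: eq_fsbigr => -[j k] _; rewrite /w /dv /=; case: ifP => // /negP ndv.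
  case: eqP => // E; case: ndv.
  (* Since - s = r modulo p, the exponent is r j modulo p, and r is invertible there. *)
  have crp : coprimez p r%:Z by rewrite coprimezE /coprime gcdnC gcdnDl.
  rewrite -(Gauss_dvdzr _ crp).
  have : (p%:Z %| n%:Z - (r * j0)%N%:Z)%Z.
    by rewrite -eqz_mod_dvd; apply/eqP; rewrite !modz_nat nE.
  rewrite -E /lambert_exp -/p /=.
  have -> : p%:Z * (k * (1 - 2 * j)) - s%:Z * j - (r * j0)%N%:Z =
     r%:Z * (j - j0%:Z) + p%:Z * (k * (1 - 2 * j) - j).
    by rewrite PoszM /p PoszD; ring.
  by rewrite rpredDr // dvdz_mulr.
pose h x := if dv x then (j0%:Z + p%:Z * x.2, ((x.1 - j0%:Z) %/ p%:Z)%Z) else x.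
have dvE x : dv x -> exists i, x.1 = j0%:Z + p%:Z * i.
  by move=> /dvdzP[i E]; exists i; rewrite mulrC -E; ring.
have hE i k : h (j0%:Z + p%:Z * i, k) = (j0%:Z + p%:Z * k, i).
  have E : j0%:Z + p%:Z * i - j0%:Z = i * p%:Z by ring.
  by rewrite /h /dv /= E dvdz_mull // mulzK.
apply: (@zser_anti _ h).
- move=> [j k]; case dx: (dv (j, k)); last by rewrite /h !dx.
  by have [i /= ->] := dvE _ dx; rewrite !hE.
- move=> [j k]; case dx: (dv (j, k)); last by rewrite /h /w !dx oppr0.
  have [i /= ->] := dvE _ dx; rewrite hE /w /dv /= !(addrC j0%:Z) !addrK !dvdz_mulr //.
  (* As 0 < j0 <= p, the sign test on j = j0 + p i becomes one on i. *)
  have posE z : (0 < p%:Z * z + j0%:Z) = (0 <= z).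
    have ? : 0 < j0%:Z <= p%:Z by rewrite /p; lia.
    by case: (lerP 0 z) => ?; apply/idP/idP => //; nia.
  by rewrite /cone !posE; ring.
move=> [j k]; case dx: (dv (j, k)); last by rewrite /w dx.
(* As 1 - 2 j0 = - s, the exponent is - 2 p^2 i k - p s (i + k) - s j0. *)
have [i /= -> _] := dvE _ dx; rewrite hE /lambert_exp /= -/p sE; ring.
Qed.

(** In the coefficient of q^n in f g only the indices i = n mod p survive; those below n vanish by
    induction, which leaves f n. *)
Lemma fps_progression_eq0 (f g h : fps) (p c : nat) :
  fps_mul f g = h -> g 0%N = 1 -> (forall n, ~~ (p %| n)%N -> g n = 0) ->
  (forall n, n = c %[mod p] -> h n = 0) -> forall n, n = c %[mod p] -> f n = 0.
Proof.
move=> fgh g0 gp hc; elim/ltn_ind=> n IH nc.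
have := hc n nc; rewrite -fgh /fps_mul big_ord_recr /= subnn g0 mulr1.
rewrite big1 ?add0r // => i _.
have [pni|/gp->] := boolP (p %| n - i)%N; last by rewrite mulr0.
rewrite IH ?mul0r // -nc; apply/eqP.
by rewrite eq_sym eqn_mod_dvd // ltnW.
Qed.

(** * The finite Jacobi triple product *)

Section GaussBinomial.
Variables (R : comNzRingType) (x : R).

Fixpoint gbin (m j : nat) : R :=
  match m, j with
  | _, 0%N => 1
  | 0%N, _.+1 => 0
  | m'.+1, j'.+1 => gbin m' j' + x ^+ j'.+1 * gbin m' j'.+1
  end.

Arguments gbin : simpl never.

Lemma gbin0 m : gbin m 0 = 1. Proof. by case: m. Qed.

Lemma gbinS m j : gbin m.+1 j.+1 = gbin m j + x ^+ j.+1 * gbin m j.+1.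
Proof. by []. Qed.

Lemma gbin_small m j : (m < j)%N -> gbin m j = 0.
Proof.
elim: m j => [|m IH] [|j] //; rewrite ltnS => mj.
by rewrite gbinS !IH ?mulr0 ?addr0 // ltnW.
Qed.

(** This is the quotient of neighbouring Gaussian binomials, cross-multiplied to avoid division. For
    j >= m both sides are 0, the truncated [m - j] being 0. *)
Lemma gbin_ratio m j :
  gbin m j.+1 * (1 - x ^+ j.+1) = gbin m j * (1 - x ^+ (m - j)).
Proof.
elim: m j => [|m IH] j; first by rewrite sub0n expr0 subrr mulr0 mul0r.
case: j => [|j].
  rewrite gbinS !gbin0 mulrDl -mulrA IH gbin0 !subn0 !exprS expr0; ring.
rewrite (gbinS m j.+1) mulrDl -mulrA IH (gbinS m j) [RHS]mulrDl subSS.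
have -> : gbin m j * (1 - x ^+ (m - j)) = gbin m j.+1 * (1 - x ^+ j.+1) by rewrite IH.
have [jm|mj] := ltnP j m; last by rewrite gbin_small // ; ring.
have -> : (m - j = (m - j.+1).+1)%N by lia.
by rewrite !exprS; ring.
Qed.

(** Removing the factor k = 0 replaces w by w x, so the induction runs over all w; the powers of w
    are then matched by the q-Pascal rule. The homogeneous form allows u to be a power of q that
    clears negative exponents. *)
Lemma gauss_rothe (u w : R) m :
  \prod_(k < m) (u + w * x ^+ k) =
  \sum_(j < m.+1) x ^+ 'C(j, 2) * gbin m j * w ^+ j * u ^+ (m - j).
Proof.
elim: m w => [|m IH] w; first by rewrite big_ord0 big_ord1 /= !mulr1.
rewrite big_ord_recl expr0 mulr1.
rewrite (eq_bigr (fun k : 'I_m => u + w * x * x ^+ k)) => [|k _]; last first.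
  by rewrite /= /bump leq0n exprS mulrA.
rewrite IH mulrDl [RHS]big_ord_recl /= gbin0 !(expr0, mulr1, mul1r) subn0.
transitivity (u ^+ m.+1
   + \sum_(j < m.+1) x ^+ ('C(j.+1, 2) + j.+1) * gbin m j.+1 * w ^+ j.+1 * u ^+ (m - j)
   + \sum_(j < m.+1) x ^+ 'C(j.+1, 2) * gbin m j * w ^+ j.+1 * u ^+ (m - j)).
  congr (_ + _).
    rewrite big_ord_recl /= gbin0 !(expr0, mulr1, mul1r) subn0 mulrDr -exprS.
    congr (_ + _).
    rewrite [RHS]big_ord_recr /= gbin_small // !(mulr0, mul0r) addr0 big_distrr /=.
    apply: eq_bigr => j _; rewrite /bump leq0n add1n.
    have -> : (m - j = (m - j.+1).+1)%N by have := ltn_ord j; lia.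
    rewrite exprMn exprD (exprS u).
    by move: (x ^+ _) (gbin _ _) (w ^+ _) (u ^+ _) (x ^+ _) => *; ring.
  rewrite big_distrr /=; apply: eq_bigr => j _.
  rewrite binS bin1 exprD exprMn (exprS w).
  by move: (x ^+ _) (gbin _ _) (w ^+ _) (u ^+ _) (x ^+ _) => *; ring.
rewrite -addrA -big_split; congr (_ + _); apply: eq_bigr => j _.
rewrite /= /bump leq0n add1n subSS gbinS exprD.
by move: (x ^+ _) (gbin _ _) (w ^+ _) (u ^+ _) (x ^+ _) (gbin _ _) => *; ring.
Qed.

End GaussBinomial.

Lemma mul2_bin2 n : (2 * 'C(n, 2) + n = n * n)%N.
Proof. by elim: n => [//|n]; rewrite binS bin1; nia. Qed.

(* Rothe's identity for [prod_(k < 2 N) (q^(2 p N) - q^(r + 2 p k))]: the factors with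
   [k < N] give [1 - q^(2 p - r + 2 p t)], those with [k >= N] give
   [1 - q^(r + 2 p t)], up to a common power of [q]. *)
Lemma finite_triple_product (p r N : nat) : (0 < r < p.*2)%N ->
  \prod_(t < N) (1 - 'X^r * 'X^(p.*2) ^+ t) *
  \prod_(t < N) (1 - 'X^(p.*2 - r) * 'X^(p.*2) ^+ t) =
  \sum_(j < (N + N).+1) (theta_wt (j%:Z - N%:Z))%:P *
    (gbin 'X^(p.*2) (N + N) j * 'X^(`|theta_exp p r (j%:Z - N%:Z)|)) :> {poly int}.
Proof.
move=> rp; pose q : {poly int} := 'X.
(* The factors k < N contribute the sum of r + 2 p k, that is r N + p (N^2 - N), and the sign
   (-1)^N; each of the other N contributes 2 p N. *)
pose E := (r * N + p * (N * N - N) + p.*2 * N * N)%N.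
have q0 : (-1) ^+ N * q ^+ E != 0.
  by rewrite mulf_neq0 ?expf_neq0 ?oppr_eq0 ?oner_eq0 ?polyX_eq0.
apply: (mulfI q0).
transitivity (\prod_(k < N + N) (q ^+ (p.*2 * N) + (- q ^+ r) * (q ^+ p.*2) ^+ k)).
  rewrite big_split_ord /= [X in _ = X * _](reindex_inj rev_ord_inj) /=.
  rewrite [X in _ = X * _](eq_bigr (fun t : 'I_N => - q ^+ (r + p.*2 * (N - t.+1)) *
     (1 - 'X^(p.*2 - r) * 'X^(p.*2) ^+ t))) => [|t _]; last first.
    rewrite -/q -!exprM mulrBr mulr1 mulrA !mulNr -!exprD opprK addrC.
    by congr (_ + q ^+ _); have := ltn_ord t; nia.
  rewrite [X in _ = _ * X](eq_bigr (fun t : 'I_N => q ^+ (p.*2 * N) *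
     (1 - 'X^r * 'X^(p.*2) ^+ t))) => [|t _]; last first.
    by rewrite -/q -!exprM mulrBr mulr1 mulrA !mulNr -!exprD; congr (_ - q ^+ _); nia.
  rewrite !big_split /= prodr_const card_ord prodrN card_ord -expr_sum.
  have sumE : (\sum_(t < N) (r + p.*2 * (N - t.+1)) = r * N + p * (N * N - N))%N.
    rewrite (reindex_inj rev_ord_inj) /=.
    rewrite (eq_bigr (fun t : 'I_N => (r + p.*2 * t))%N) => [|t _]; last first.
      by congr (_ + _ * _)%N; have := ltn_ord t; lia.
    elim: (N) => [|n IH]; first by rewrite big_ord0; nia.
    have -> : (n.+1 * n.+1 - n.+1 = n * n - n + n.*2)%N by nia.
    by rewrite big_ord_recr /= IH mulnDr; nia.
  by rewrite sumE -exprM /E exprD; ring.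
rewrite gauss_rothe big_distrr; apply: eq_bigr => j _ /=.
have expE : (p.*2 * 'C(j, 2) + r * j + p.*2 * N * (N + N - j) =
    E + `|theta_exp p r (j%:Z - N%:Z)|)%N.
  have NN : (N <= N * N)%N by case: (N) => // n; rewrite leq_pmulr.
  have jN : (j <= N + N)%N by rewrite -ltnS.
  apply: (can_inj absz_nat); rewrite !PoszD !PoszM -!subzn // -!muln2 !PoszM gez0_abs.
    have C2 : 'C(j, 2)%:Z * 2 = j%:Z * j%:Z - j%:Z.
      by have := mul2_bin2 j; lia.
    rewrite mulrAC -mulrA C2 /theta_exp PoszD; ring.
  by apply: le_trans (theta_exp_ge _ rp).
have -> : theta_wt (j%:Z - N%:Z) = (-1) ^+ N * (-1) ^+ j.
  by rewrite theta_wtD theta_wtN mulrC.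
rewrite -!exprM (exprNn (q ^+ r)) -!exprM rmorphM !rmorphXn rmorphN1 -/q.
transitivity ((-1) ^+ j * gbin (q ^+ p.*2) (N + N) j *
    q ^+ (E + `|theta_exp p r (j%:Z - N%:Z)|)).
  rewrite -expE !exprD.
  by move: ((-1) ^+ j) (q ^+ _) (q ^+ _) (q ^+ _) (gbin _ _ _) => *; ring.
have := sqrr_sign {poly int} N; rewrite expr2 => sN.
rewrite exprD -[LHS]mul1r -{1}sN.
by move: ((-1) ^+ N) ((-1) ^+ j) (q ^+ _) (q ^+ E) (gbin _ _ _) => *; ring.
Qed.

(** * From infinite products to theta series *)

(** Consecutive j are compared by [gbin_ratio]: for M <= j < 3M, both powers 2p (j + 1) and 2p (4M -
    j) exceed e, so neither correction is visible at q^e. *)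
Lemma gbin_stable (p M j e : nat) : (0 < p)%N -> (M <= j <= 3 * M)%N -> (e < M)%N ->
  (gbin 'X^(p.*2) (M.*2 + M.*2) j : {poly int})`_e =
  (gbin 'X^(p.*2) (M.*2 + M.*2) M : {poly int})`_e.
Proof.
move=> p0 Mj eM; have [d -> dM] : exists2 d, j = (M + d)%N & (d <= M.*2)%N.
  by exists (j - M)%N; lia.
elim: d dM {Mj} => [|d IH] dM; first by rewrite addn0.
rewrite -IH; last by lia.
have := gbin_ratio ('X^(p.*2) : {poly int}) (M.*2 + M.*2) (M + d).
rewrite -!exprM !mulrBr !mulr1 => /(congr1 (fun f : {poly int} => f`_e)).
rewrite !coefB !coefMXn !ifT ?subr0 -?addnS //; nia.
Qed.

Lemma qpoch2_prod (a1 a2 b : {poly int}) (e N : nat) : b`_0 = 0 -> (e < N)%N ->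
  qpoch2 a1 a2 b e =
  (\prod_(t < N) (1 - a1 * b ^+ t) * \prod_(t < N) (1 - a2 * b ^+ t))`_e.
Proof.
move=> b0 eN; rewrite coefM; apply: eq_bigr => i _.
by have := ltn_ord i => ?; rewrite !qpoch_stable //; lia.
Qed.

(* The proportionality factor, which is [1 / (q^(2p); q^(2p))_oo] to precision [M],
   is the same for all [r]; its value never matters. *)
Lemma qpoch2_theta (p M : nat) : exists g : fps, forall r e : nat,
  (0 < r < p.*2)%N -> (e < M)%N ->
  qpoch2 'X^r 'X^(p.*2 - r) 'X^(p.*2) e = fps_mul g (theta p r) e.
Proof.
(* With N = 2M, a term of exponent at most e < M has |j - N| < M, so j lies in the range covered by
   [gbin_stable]. *)
pose N := M.*2; pose G j : {poly int} := gbin 'X^(p.*2) (N + N) j.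
exists (fun i => (G M)`_i) => r e rp eM.
have p0 : (0 < p)%N by lia.
have eN : (e < N)%N by rewrite /N; lia.
rewrite (@qpoch2_prod _ _ _ e N) //; last by rewrite coefXn; case: (p) p0.
rewrite finite_triple_product // fps_mulC coef_sum /fps_mul.
have thetaE i : (i <= e)%N -> theta p r i =
    \sum_(j < (N + N).+1) theta_wt (j%:Z - N%:Z) *+
      (theta_exp p r (j%:Z - N%:Z) == i%:Z).
  move=> ie; rewrite /theta (@zserE _ _ _ (int_box N)) ?int_box_uniq //; last first.
    move=> x _ xi; apply: mem_int_box; have := theta_exp_ge x rp; lia.
  rewrite big_map -addnn -(big_mkord xpredT (fun j : nat =>
    theta_wt (j%:Z - N%:Z) *+ (theta_exp p r (j%:Z - N%:Z) == i%:Z))).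
  by rewrite /index_iota subn0.
transitivity (\sum_(i < e.+1) \sum_(j < (N + N).+1) theta_wt (j%:Z - N%:Z) *+
   (theta_exp p r (j%:Z - N%:Z) == i%:Z) * (G M)`_(e - i)); last first.
  by apply: eq_bigr => i _; rewrite thetaE ?big_distrl // -ltnS ltn_ord.
rewrite exchange_big; apply: eq_bigr => j _ /=; rewrite coefCM coefMXn.
set z := j%:Z - N%:Z; have := theta_exp_ge z rp.
case: (theta_exp p r z) => // t; rewrite absz_nat => tz.
case: ltnP => et.
  rewrite mulr0 big1 // => i _; have -> : (t%:Z == i%:Z) = false.
    by have := ltn_ord i; lia.
  by rewrite mulr0n mul0r.
have te : (t < e.+1)%N by [].
rewrite (bigD1 (Ordinal te)) //= eqxx big1 ?addr0 => [|i ne]; last first.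
  suff -> : (t%:Z == i%:Z) = false by rewrite mulr0n mul0r.
  by apply: contraNF ne => /eqP[ti]; apply/eqP/val_inj.
rewrite mulr1n gbin_stable //; rewrite ?/z ?/N in tz *; have := ltn_ord j; lia.
Qed.

(** To any precision both sides are g theta(r) theta(r') with the same g. *)
Lemma qpoch2_theta_ratio (p r r' : nat) : (0 < r < p.*2)%N -> (0 < r' < p.*2)%N ->
  fps_mul (qpoch2 'X^r 'X^(p.*2 - r) 'X^(p.*2)) (theta p r') =
  fps_mul (qpoch2 'X^r' 'X^(p.*2 - r') 'X^(p.*2)) (theta p r).
Proof.
move=> rp r'p; apply: funext => n; have [g gP] := qpoch2_theta p n.+1.
have mulE r1 r2 : (0 < r1 < p.*2)%N ->
    fps_mul (qpoch2 'X^r1 'X^(p.*2 - r1) 'X^(p.*2)) (theta p r2) n =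
    fps_mul (fps_mul g (theta p r1)) (theta p r2) n.
  by move=> ?; apply: eq_bigr => i _; rewrite gP.
by rewrite !mulE // -!fps_mulA (fps_mulC (theta p r)).
Qed.

(** * Quotients of theta products *)

Lemma theta_quotient_eq0 (r s n : nat) : (0 < r)%N -> odd s -> coprime r s ->
  n = r * s.+1./2 %[mod r + s] ->
  fps_div (qpoch2 'X^r 'X^(r + s.*2) 'X^((r + s).*2))
          (qpoch2 'X^s 'X^(r.*2 + s) 'X^((r + s).*2)) n = 0.
Proof.
move=> r0 os crs; have s0 : (0 < s)%N by case: (s) os.
set p := (r + s)%N; set num := qpoch2 _ _ _; set den := qpoch2 _ _ _.
have den0 : den 0%N = 1 by rewrite /den qpoch2_0 // coefXn; lia.
have numE : num = qpoch2 'X^r 'X^(p.*2 - r) 'X^(p.*2).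
  by congr qpoch2; congr ('X^_); rewrite /p; lia.
(* Here r + p = 2 r + s and 2 p - (r + p) = s, so the two products in [den] are swapped. *)
have denE : den = qpoch2 'X^(r + p) 'X^(p.*2 - (r + p)) 'X^(p.*2).
  rewrite /den /qpoch2 fps_mulC -/(qpoch2 _ _ _).
  by congr qpoch2; congr ('X^_); rewrite /p; lia.
have theta0 r' : (0 < r' < p.*2)%N -> theta p r' 0%N = 1.
  move=> rp; rewrite /theta (@zserE _ _ _ [:: 0]) // ?big_seq1.
    by rewrite /theta_exp !mulr0.
  by move=> x _ x0; have := theta_exp_ge x rp; rewrite x0 inE; lia.
have ratio : fps_mul num (theta p (r + p)) = fps_mul den (theta p r).
  by rewrite numE denE; apply: qpoch2_theta_ratio; rewrite /p; lia.
have fden : fps_mul (fps_div num den) den = num.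
  by apply: funext; apply: fps_divK; rewrite den0 unitr1.
(* Multiply by den theta(r + p), which has constant term 1 and can be cancelled; then [fden],
   [ratio] and [theta_lambert] apply in turn. *)
have fK : fps_mul (fps_div num den) (kfactor p) = lambert r s.
  have u0 : fps_mul den (theta p (r + p)) 0%N \is a GRing.unit.
    by rewrite /fps_mul big_ord1 den0 theta0 ?mulr1 ?unitr1 // /p; lia.
  apply: (fps_mulI u0); set f := fps_div _ _ in fden *.
  have -> : fps_mul (fps_mul f (kfactor p)) (fps_mul den (theta p (r + p))) =
            fps_mul (fps_mul (fps_mul f den) (theta p (r + p))) (kfactor p).
    by rewrite -(fps_mulA f) (fps_mulC (kfactor p)) !fps_mulA.
  rewrite fden ratio -fps_mulA -theta_lambert //.
  by rewrite fps_mulA fps_mulC.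
apply: (fps_progression_eq0 fK); first exact: kfactor0.
  exact: kfactor_supp.
by move=> m; apply: lambert_eq0.
Qed.

Theorem theorem3p3 (alpha beta gamma alpha' beta' gamma' : nat -> int)
  (def_alpha : alpha =1
     fps_div (qpoch2 'X^4 'X^10 'X^14) (qpoch2 'X^3 'X^11 'X^14))
  (def_beta : beta =1
     fps_div (qpoch2 'X^2 'X^12 'X^14) (qpoch2 'X^5 'X^9 'X^14))
  (def_gamma : gamma =1
     fps_div (qpoch2 'X^6 'X^8 'X^14) (qpoch2 'X 'X^13 'X^14))
  (def_alpha' : alpha' =1
     fps_div (qpoch2 'X 'X^27 'X^28) (qpoch2 'X^13 'X^15 'X^28))
  (def_beta' : beta' =1
     fps_div (qpoch2 'X^3 'X^25 'X^28) (qpoch2 'X^11 'X^17 'X^28))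
  (def_gamma' : gamma' =1
     fps_div (qpoch2 'X^5 'X^23 'X^28) (qpoch2 'X^9 'X^19 'X^28))
  (n : nat) :
  alpha (7 * n + 1)%N = 0 /\
  beta (7 * n + 6)%N = 0 /\
  gamma (7 * n + 6)%N = 0 /\
  alpha' (14 * n + 7)%N = 0 /\
  beta' (14 * n + 4)%N = 0 /\
  gamma' (14 * n + 11)%N = 0.
Proof.
have mod7 c : 7 * n + c = c %[mod 7] by rewrite mulnC modnMDl.
have mod14 c : 14 * n + c = c %[mod 14] by rewrite mulnC modnMDl.
rewrite def_alpha def_beta def_gamma def_alpha' def_beta' def_gamma'.
rewrite -(expr1 'X); do !split.
(* The values of r (s + 1) / 2 are 8, 6, 6 modulo 7, then 7, 18, 25 modulo 14. *)
- by apply: (@theta_quotient_eq0 4 3) => //; rewrite mod7.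
- by apply: (@theta_quotient_eq0 2 5) => //; rewrite mod7.
- by apply: (@theta_quotient_eq0 6 1) => //; rewrite mod7.
- by apply: (@theta_quotient_eq0 1 13) => //; rewrite mod14.
- by apply: (@theta_quotient_eq0 3 11) => //; rewrite mod14.
by apply: (@theta_quotient_eq0 5 9) => //; rewrite mod14.
Qed.
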